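(* Let $1\le m\le n$ and let $f\in W^{1,1}_{\mathrm{loc}}(\mathbb{R}^n;\mathbb{R}^m)$ (a fixed pointwise defined representative). Let $\bar f(x)=(x,f(x))$, $\mathcal{G}_f=\bar f(\mathbb{R}^n)$ and $\pi:\mathbb{R}^{n+m}\to\mathbb{R}^n$, $\pi(x,x_{n+1},\dots,x_{n+m})=x$. Suppose there is $\theta\in L^1_{\mathrm{loc}}(\mathbb{R}^n)$ such that $$\mathcal{H}^{n-m}_\infty\bigl(\pi(\mathcal{G}_f\cap B(z,r))\bigr)\le r^{-m}\int_{\pi(\mathcal{G}_f\cap B(z,4r))}\theta(x)\,dx$$ for all $z\in\mathbb{R}^{n+m}$ and $r>0$. Then there is a constant $C=C(m,n)$ such that $$\mathcal{H}^n(\bar f(E))\le C\int_E\theta(x)\,dx$$ for all $\mathcal{L}^n$ measurable $E\subset\mathbb{R}^n$. In particular, $\bar f$ satisfies condition (N), i.e. $\mathcal{H}^n(\bar f(E))=0$ whenever $\mathcal{L}^n(E)=0$.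
   Context: For $q\ge0$, $\mathcal{H}^q_\infty(E)$ is the infimum of $\sum_j\boldsymbol\alpha_q(\mathrm{diam}\,E_j/2)^q$ over countable coverings $\{E_j\}$ of $E$, with $\boldsymbol\alpha_q=\pi^{q/2}/\Gamma(\frac q2+1)$; $\mathcal{H}^n$ is $n$-dimensional Hausdorff measure. *)

(* Defs.v *)
From HB Require Import structures.
From mathcomp Require Import all_boot all_order all_algebra.
From mathcomp Require Import all_classical all_reals all_analysis.
Set Implicit Arguments. Unset Strict Implicit. Unset Printing Implicit Defensive.
Import Order.TTheory GRing.Theory Num.Theory.
Import numFieldNormedType.Exports.
Local Open Scope classical_set_scope.
Local Open Scope ring_scope.

Definition discr (T : Type) := T.
HB.instance Definition _ (T : pointedType) := Pointed.on (discr T).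
HB.instance Definition _ (T : pointedType) := @isMeasurable.Build default_measure_display
  (discr T) discrete_measurable discrete_measurable0
  discrete_measurableC discrete_measurableU.

Section defs.
Variable R : realType.

Definition enorm k (v : 'rV[R]_k) : R := Num.sqrt (\sum_i v 0 i ^+ 2).

Definition eball k (z : 'rV[R]_k) (r : R) : set 'rV[R]_k :=
  [set y | enorm (y - z) < r].

Definition box k (a b : 'rV[R]_k) : set 'rV[R]_k :=
  [set x | forall i, a 0 i <= x 0 i < b 0 i].

Local Open Scope ereal_scope.

Definition boxvol k (F : set (discr 'rV[R]_k)) : \bar R :=
  if pselect (F = set0) then 0 else
  ereal_inf [set (\prod_i (ab.2 0 i - ab.1 0 i))%:E | ab in
     [set ab : 'rV[R]_k * 'rV[R]_k | (forall i, ab.1 0 i <= ab.2 0 i)%R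
                                      /\ F = box ab.1 ab.2]].

Lemma boxvol0 k : boxvol (set0 : set (discr 'rV[R]_k)) = 0.
Proof. by rewrite /boxvol; case: pselect. Qed.

Lemma boxvol_ge0 k (F : set (discr 'rV[R]_k)) : 0 <= boxvol F.
Proof.
rewrite /boxvol; case: pselect => [h|h]; first by [].
apply: le_ereal_inf_tmp => x [ab [hab h2] hx]; rewrite -hx lee_fin.
by apply: prodr_ge0 => i _; rewrite subr_ge0.
Qed.

Definition leb_outer k : set (discr 'rV[R]_k) -> \bar R := mu_ext (@boxvol k).


HB.instance Definition _ k := isOuterMeasure.Build R _ (@leb_outer k)
  (mu_ext0 (@boxvol0 k) (@boxvol_ge0 k)) (mu_ext_ge0 (@boxvol_ge0 k))
  (le_mu_ext (@boxvol k)) (mu_ext_sigma_subadditive (@boxvol_ge0 k)).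

Definition LebT k := caratheodory_type (@leb_outer k).

Definition lebn k : set (LebT k) -> \bar R := @leb_outer k.

Definition Gamma (x : R) : R :=
  fine (\int[@lebesgue_measure R]_(t in `]0%R, +oo[%classic)
          ((t `^ (x - 1)) * expR (- t))%:E).

Definition alpha (q : nat) : R :=
  (pi `^ (q%:R / 2) / Gamma (q%:R / 2 + 1))%R.

Definition diam k (F : set 'rV[R]_k) : \bar R :=
  ereal_sup [set (enorm (xy.1 - xy.2))%:E | xy in F `*` F].

Definition hterm k (q : nat) (delta : \bar R) (F : set (discr 'rV[R]_k)) : \bar R :=
  if pselect (F = set0) then 0
  else if delta < diam F then +oo
  else (alpha q)%:E * iter q (fun y => y * (diam F * (2^-1)%:E)) 1.

Definition hcontent k (q : nat) : set 'rV[R]_k -> \bar R :=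
  mu_ext (@hterm k q +oo).

Definition hmeasure k (q : nat) (A : set 'rV[R]_k) : \bar R :=
  ereal_sup [set mu_ext (@hterm k q d%:E) A | d in `]0%R, +oo[%classic].


Local Close Scope ereal_scope.
Fixpoint pderivs k (l : seq 'I_k) (phi : 'rV[R]_k -> R) : 'rV[R]_k -> R :=
  match l with
  | [::] => phi
  | i :: l' => fun x => derive (pderivs l' phi) x (delta_mx 0 i)
  end.

Definition smooth k (phi : 'rV[R]_k -> R) : Prop :=
  forall l : seq 'I_k, continuous (pderivs l phi) /\
    forall i x, derivable (pderivs l phi) x (delta_mx 0 i).

Definition test_fun k (phi : 'rV[R]_k -> R) : Prop :=
  smooth phi /\ exists K : set 'rV[R]_k, compact K /\ forall x, ~ K x -> phi x = 0%R.

Definition L1loc k (g : 'rV[R]_k -> R) : Prop :=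
  measurable_fun [set: LebT k] (g : LebT k -> R) /\
  forall K : set 'rV[R]_k, compact K -> (@lebn k).-integrable (K : set (LebT k)) (fun x : LebT k => (g x)%:E).

Definition weak_pderiv k (u g : 'rV[R]_k -> R) (i : 'I_k) : Prop :=
  forall phi, test_fun phi ->
    (\int[@lebn k]_x (u x * derive phi x (delta_mx 0 i))%:E
     = - \int[@lebn k]_x (g x * phi x)%:E)%E.

Definition W11loc k m (f : 'rV[R]_k -> 'rV[R]_m) : Prop :=
  forall j : 'I_m, L1loc (fun x => f x 0 j) /\
    forall i : 'I_k, exists g, L1loc g /\ weak_pderiv (fun x => f x 0 j) g i.

Definition fbar k m (f : 'rV[R]_k -> 'rV[R]_m) (x : 'rV[R]_k) : 'rV[R]_(k + m) :=
  row_mx x (f x).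

Definition projn k m (y : 'rV[R]_(k + m)) : 'rV[R]_k := lsubmx y.

End defs.

(* Main.v *)
(** Write G for the graph of f, nu(A) for the integral of theta^+ over A, and
    q = n - m. The hypothesis, which also holds for theta^+, is used at every
    centre and radius, so no differentiability of f is needed.

    Cover the projection of G /\ B(z,r) by sets E_j of diameter d_j with
    sum_j d_j^q <~ r^-m nu(B(z,4r)). Each slab E_j x B(z'',r) splits into
    about (r/d_j)^m pieces of diameter about d_j, of total n-dimensional cost
    r^m d_j^q; hence H^n_{Kr}(G /\ B(z,r)) <~ nu(B(z,4r)), where on the right
    the ball stands for its preimage under the graph map. Summing over balls
    centred at a lattice of mesh comparable to r, whose dilates have bounded
    overlap, and letting r -> 0, one gets H^n(fbar A) <~ nu(W) as soon as W
    contains a uniform neighbourhood of A. For a measurable bounded E, an open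
    set V containing E with V \ E small is exhausted by U_j, each contained in
    U_{j+1} together with a uniform neighbourhood; applying the bound to the
    layers U_{j+1} \ U_j gives H^n(fbar V) <~ nu(V), and absolute continuity of
    nu yields H^n(fbar E) <~ nu(E).

    Finally, on P = {theta <= 0} this gives H^n(fbar P) = 0, so P is Lebesgue
    null because projections do not increase H^n; thus theta = theta^+ a.e. *)
Require Import Defs.
From HB Require Import structures.
From mathcomp Require Import all_boot all_order all_algebra.
From mathcomp Require Import all_classical all_reals all_analysis.
From mathcomp Require Import measurable_realfun ring lra zify.
Set Implicit Arguments. Unset Strict Implicit. Unset Printing Implicit Defensive.
Import Order.TTheory GRing.Theory Num.Theory.
Import numFieldNormedType.Exports.
Local Open Scope classical_set_scope.
Local Open Scope ring_scope.

(** * Positivity of the normalising constant *)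

(** [Gamma] is the [fine] of an integral, and [fine] sends +oo to 0, so the integral has to be shown
    finite as well as positive. *)
Lemma alpha_gt0 (R : realType) (q : nat) : 0 < alpha R q.
Proof.
rewrite /alpha divr_gt0 ?powR_gt0 ?pi_gt0//.
pose D : set R := `]0%R, +oo[%classic.
pose g (t : R) := t `^ (q%:R / 2 + 1 - 1) * expR (- t).
have mD : measurable (D : set R) by exact: measurable_itv.
have g0 t : 0 <= g t by rewrite mulr_ge0 ?powR_ge0 ?expR_ge0.
have mg : measurable_fun setT g.
  apply: measurable_funM; first exact: measurable_powR.
  by apply: measurableT_comp => //; exact: measurable_funB.
(* From 1 + t <= 2(q+1) (1 + t/(2(q+1))) <= 2(q+1) exp(t/(2(q+1))): in the q-th power the exponent
   is at most t/2. *)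
pose M : R := (2 * q.+1%:R) ^+ q.
(* e^-t t^(q/2) <= M e^(-t/2), a multiple of the exponential density of rate 1/2. *)
pose h (t : R) := 2 * M * exponential_pdf 2^-1 t.
have gh t : D t -> g t <= h t.
  rewrite /D /= in_itv/= andbT => t0.
  rewrite /g /h (exponential_pdfE _ (ltW t0)) addrK.
  have -> : 2 * M * (2^-1 * expR (- 2^-1 * t)) = M * expR (t / 2) * expR (- t).
    rewrite -[RHS]mulrA -expRD (_ : t / 2 + - t = - 2^-1 * t); last by field.
    by field.
  rewrite ler_wpM2r ?expR_ge0//.
  have q1 : 0 < 2 * q.+1%:R :> R by rewrite mulr_gt0.
  have tq0 : 0 <= t / (2 * q.+1%:R) by rewrite divr_ge0 ?(ltW t0) ?(ltW q1).
  apply: (@le_trans _ _ ((1 + t) ^+ q)).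
    apply: (@le_trans _ _ ((1 + t) `^ (q%:R / 2))).
      rewrite ge0_ler_powR ?nnegrE ?divr_ge0 ?addr_ge0 ?(ltW t0)//.
      by rewrite lerDr.
    rewrite -powR_mulrn ?addr_ge0 ?(ltW t0)//.
    rewrite ler_powR ?lerDl ?(ltW t0)//.
    by rewrite ler_pdivrMr// ler_peMr// ler1n.
  apply: (@le_trans _ _ (M * (1 + t / (2 * q.+1%:R)) ^+ q)).
    rewrite -exprMn lerXn2r ?nnegrE ?(mulr_ge0 (ltW q1)) ?addr_ge0 ?tq0 ?(ltW t0)//.
    rewrite mulrDr mulr1 [_ * (t / _)]mulrCA divff ?gt_eqF// mulr1 lerD2r.
    by rewrite -natrM ler1n.
  rewrite ler_wpM2l ?exprn_ge0 ?(ltW q1)//.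
  apply: (@le_trans _ _ (expR (t / (2 * q.+1%:R)) ^+ q)).
    rewrite lerXn2r ?nnegrE ?addr_ge0 ?expR_ge0 ?tq0//.
    exact: expR_ge1Dx.
  rewrite -expRM_natl ler_expR.
  have -> : q%:R * (t / (2 * q.+1%:R)) = t / 2 * (q%:R / q.+1%:R) by field; rewrite -natr1 in q1 *; lra.
  rewrite ler_piMr ?divr_ge0 ?(ltW t0)//.
  by rewrite ler_pdivrMr// mul1r ler_nat.
rewrite /Gamma -/D fine_gt0//; apply/andP; split; last first.
  have h0 t : (0 <= (h t)%:E)%E.
    by rewrite lee_fin mulr_ge0 ?exponential_pdf_ge0 ?mulr_ge0 ?exprn_ge0.
  have mh : measurable_fun setT h.
    by apply: measurable_funM => //; exact: measurable_exponential_pdf.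
  apply: (@le_lt_trans _ _ (\int[lebesgue_measure]_(t in D) (h t)%:E)%E).
    apply: ge0_le_integral => //.
    - by move=> t _; rewrite lee_fin g0.
    - by apply/measurable_EFinP; exact: measurable_funTS.
    - by apply/measurable_EFinP; exact: measurable_funTS.
  apply: (@le_lt_trans _ _ (\int[lebesgue_measure]_t (h t)%:E)%E).
    by apply: ge0_subset_integral => //; exact/measurable_EFinP.
  under eq_integral do rewrite EFinM.
  rewrite ge0_integralZl//=.
  - by rewrite integral_exponential_pdf ?invr_gt0// mule1 ltry.
  - by apply/measurable_EFinP; exact: measurable_exponential_pdf.
  - by move=> t _; rewrite lee_fin exponential_pdf_ge0.
  - by rewrite lee_fin mulr_ge0// exprn_ge0.
(* Positivity: on [1, 2] the power is at least 1 and the exponential at least e^-2. *)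
have sub : `[1%R, 2%R]%classic `<=` D.
  by move=> t; rewrite /D/= !in_itv/= andbT => /andP[t1 _]; exact: lt_le_trans t1.
apply: (@lt_le_trans _ _ (\int[lebesgue_measure]_(t in `[1%R, 2%R]) (cst (expR (- 2))%:E t))%E).
  rewrite integral_cst//= lebesgue_measure_itv/= lte_fin ltr1n/=.
  by rewrite -EFinB -EFinM lte_fin mulr_gt0 ?expR_gt0// subr_gt0 ltr1n.
apply: (@le_trans _ _ (\int[lebesgue_measure]_(t in `[1%R, 2%R]) (g t)%:E)%E).
  apply: ge0_le_integral => //.
  - by move=> t _; rewrite lee_fin expR_ge0.
  - by apply/measurable_EFinP; exact: measurable_funTS.
  - move=> t; rewrite /= in_itv/= => /andP[t1 t2]; rewrite lee_fin /g.
    rewrite -[leLHS]mul1r ler_pM ?expR_ge0// ?ler_expR ?lerN2//.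
    by rewrite addrK -[leLHS](powRr0 t) ler_powR// divr_ge0.
apply: ge0_subset_integral => //.
- by apply/measurable_EFinP; exact: measurable_funTS.
- by move=> t _; rewrite lee_fin g0.
Qed.

(** * Hausdorff premeasures *)

Lemma neq_set0P T (A : set T) : A <> set0 <-> A !=set0.
Proof. by split=> [/eqP/set0P//|/set0P/eqP]. Qed.

Section euclidean_norm.
Context {R : realType}.

Lemma enorm_ge0 k (v : 'rV[R]_k) : 0 <= enorm v.
Proof. exact: sqrtr_ge0. Qed.

Lemma coordB k (x y : 'rV[R]_k) i : (x - y) 0 i = x 0 i - y 0 i.
Proof. by rewrite mxE [(- y) _ _]mxE. Qed.

Lemma coord_le_enorm k (v : 'rV[R]_k) i : `|v 0 i| <= enorm v.
Proof.
rewrite -sqrtr_sqr ler_wsqrtr// (bigD1 i)//= lerDl.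
by apply: sumr_ge0 => j _; exact: sqr_ge0.
Qed.

Lemma enorm_le_coord k (v : 'rV[R]_k) (s : R) :
  0 <= s -> (forall i, `|v 0 i| <= s) -> enorm v <= k%:R * s.
Proof.
move=> s0 vs; rewrite -[leRHS]ger0_norm ?mulr_ge0// -sqrtr_sqr ler_wsqrtr//.
apply: (@le_trans _ _ (\sum_(i < k) s ^+ 2)).
  by apply: ler_sum => i _; rewrite -real_normK ?num_real// lerXn2r ?nnegrE.
rewrite sumr_const card_ord -[leLHS]mulr_natl exprMn ler_wpM2r ?sqr_ge0//.
by rewrite -natrX ler_nat; case: k {v vs} => // k; rewrite leq_pmulr.
Qed.

End euclidean_norm.

Section hausdorff_outer.
Context {R : realType}.
Local Open Scope ereal_scope.

Lemma diam_ge0 k (F : set 'rV[R]_k) : F !=set0 -> 0 <= diam F.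
Proof.
move=> [x Fx]; apply: le_ereal_sup_tmp; exists (enorm (x - x))%:E.
  by exists (x, x).
by rewrite lee_fin enorm_ge0.
Qed.

Lemma diam_le k (F : set 'rV[R]_k) (s : \bar R) :
  (forall x y, F x -> F y -> (enorm (x - y))%:E <= s) -> diam F <= s.
Proof.
by move=> Fs; apply: ge_ereal_sup => _ [[x y] [/= Fx Fy] <-]; exact: Fs.
Qed.

Lemma enorm_le_diam k (F : set 'rV[R]_k) x y :
  F x -> F y -> (enorm (x - y))%:E <= diam F.
Proof. by move=> Fx Fy; apply: ereal_sup_ubound; exists (x, y). Qed.

Local Notation pow q := (fun x : \bar R => iter q (fun y => y * (x * (2^-1)%:E)) 1).

Lemma iter_half_fin q (s : R) : pow q s%:E = ((s / 2) ^+ q)%:E.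
Proof. by elim: q => //= q ->; rewrite -!EFinM exprSr. Qed.

Lemma iter_half_ge0 q x : 0 <= x -> 0 <= pow q x.
Proof.
move=> x0; elim: q => //= q ih.
by apply: mule_ge0 => //; apply: mule_ge0 => //; rewrite lee_fin.
Qed.

Lemma iter_half_le q x y : 0 <= x -> x <= y -> pow q x <= pow q y.
Proof.
move=> x0 xy; elim: q => //= q ih; apply: lee_pmul => //.
- exact: iter_half_ge0.
- by apply: mule_ge0 => //; rewrite lee_fin.
- by apply: lee_wpmul2r => //; rewrite lee_fin.
Qed.

Lemma hterm0 k q d : @hterm R k q d set0 = 0.
Proof. by rewrite /hterm; case: pselect. Qed.

Lemma hterm_ge0 k q d F : 0 <= @hterm R k q d F.
Proof.
rewrite /hterm; case: pselect => [//|nF]; have /neq_set0P F0 := nF; case: ifPn => // _.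
apply: mule_ge0; first by rewrite lee_fin ltW// alpha_gt0.
apply: iter_half_ge0; exact: diam_ge0.
Qed.

Lemma hterm_le k q d (F : set 'rV[R]_k) (s : R) :
  (0 <= s)%R -> diam F <= s%:E -> s%:E <= d ->
  hterm q d F <= (alpha R q * (s / 2) ^+ q)%:E.
Proof.
move=> s0 Fs sd; have a0 := ltW (alpha_gt0 R q).
rewrite /hterm; case: pselect => [F0|nF]; last have /neq_set0P F0 := nF.
  by rewrite lee_fin mulr_ge0// exprn_ge0// divr_ge0.
rewrite ltNge (le_trans Fs sd)/= [leRHS]EFinM; apply: lee_wpmul2l; rewrite ?lee_fin//.
by rewrite -iter_half_fin; apply: iter_half_le => //; exact: diam_ge0.
Qed.

Lemma le_hterm k q d (F : set 'rV[R]_k) (s : R) :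
  (0 <= s)%R -> F !=set0 -> s%:E <= diam F ->
  (alpha R q * (s / 2) ^+ q)%:E <= hterm q d F.
Proof.
move=> s0 /neq_set0P F0 sF; have a0 := ltW (alpha_gt0 R q).
rewrite /hterm; case: pselect => [/F0//|nF]; case: ifPn => _; first exact: leey.
rewrite [leLHS]EFinM; apply: lee_wpmul2l; rewrite ?lee_fin// -iter_half_fin.
by apply: iter_half_le => //; rewrite lee_fin.
Qed.

Lemma hterm_gt_diam k q (d : R) (F : set 'rV[R]_k) :
  F !=set0 -> hterm q d%:E F < +oo -> diam F <= d%:E.
Proof.
move=> /neq_set0P F0; rewrite /hterm; case: pselect => [/F0//|nF].
by case: ifPn => //; rewrite -leNgt.
Qed.

(** Named so that the outer measure structure can be attached; [hcontent] is the case d = +oo and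
    [hmeasure] the supremum over real d > 0. *)
Definition hdelta k q d : set (discr 'rV[R]_k) -> \bar R := mu_ext (@hterm R k q d).

HB.instance Definition _ k q d := isOuterMeasure.Build R _ (@hdelta k q d)
  (mu_ext0 (@hterm0 k q d) (@hterm_ge0 k q d)) (mu_ext_ge0 (@hterm_ge0 k q d))
  (le_mu_ext (@hterm R k q d)) (mu_ext_sigma_subadditive (@hterm_ge0 k q d)).

End hausdorff_outer.

Section mu_ext_discr.
Context {R : realType} {T : pointedType} (mu : set (discr T) -> \bar R).
Hypotheses (mu0 : mu set0 = 0%E) (mu_ge0 : forall A, (0 <= mu A)%E).
Local Open Scope ereal_scope.

Lemma mu_ext_le_self A : mu_ext mu A <= mu A.
Proof.
apply: ereal_inf_lbound; exists (fun n => if n is 0%N then A else set0).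
  by split => // x Ax; exists 0%N.
rewrite nneseries_recl//= eseries0 ?adde0//.
by case.
Qed.

(** Every subset of [discr T] is measurable, so the covers in [mu_ext] are arbitrary countable
    ones. *)
Lemma le_mu_ext_cover (c : \bar R) A :
  (forall F : (set (discr T))^nat, A `<=` \bigcup_i F i -> c <= \sum_(i <oo) mu (F i)) ->
  c <= mu_ext mu A.
Proof. by move=> h; apply: le_ereal_inf_tmp => _ [F [_ AF] <-]; exact: h. Qed.

Lemma mu_ext_approx A (e : R) : (0 < e)%R -> mu_ext mu A < +oo ->
  exists2 F : (set (discr T))^nat, A `<=` \bigcup_i F i &
    \sum_(i <oo) mu (F i) <= mu_ext mu A + e%:E.
Proof.
move=> e0 Aoo; have mf : mu_ext mu A \is a fin_num by rewrite ge0_fin_numE// mu_ext_ge0.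
have [_ [F [_ AF] <-] /ltW ?] := lb_ereal_inf_adherent e0 mf.
by exists F.
Qed.

End mu_ext_discr.

Lemma hdelta_le_hterm {R : realType} k q d (F : set 'rV[R]_k) :
  (hdelta q d F <= hterm q d F)%E.
Proof. exact: (@mu_ext_le_self R 'rV[R]_k _ (@hterm0 R k q d) (@hterm_ge0 R k q d)). Qed.

Section outer_measure_covers.
Context {R : realType} {T : Type} (mu : {outer_measure set T -> \bar R}).
Local Open Scope ereal_scope.

Lemma outer_measure_fin_cover (I : finType) (F : I -> set T) A (c : \bar R) :
  A `<=` \bigcup_i F i -> (forall i, mu (F i) <= c) -> mu A <= (#|I|%:R)%:E * c.
Proof.
move=> AF Fc.
have H (s : seq I) : mu [set x | exists2 i, i \in s & F i x] <= (size s)%:R%:E * c.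
  elim: s => [|i s ih].
    rewrite mul0e (_ : [set x | _] = set0) ?outer_measure0//.
    by apply/seteqP; split => // x [].
  have c0 : 0 <= c by exact: le_trans (outer_measure_ge0 mu (F i)) (Fc i).
  rewrite -natr1 EFinD ge0_muleDl ?lee_fin// mul1e addeC.
  apply: le_trans (leeD (Fc i) ih).
  apply: le_trans (outer_measureU2 mu _ _); apply: le_outer_measure => x [l].
  by rewrite inE => /predU1P[->|ls] Flx; [left|right; exists l].
rewrite cardE; apply: le_trans (H _); apply: le_outer_measure => x /AF[i _ Fi].
by exists i => //; rewrite mem_enum.
Qed.

(** Indices that encode no element contribute the empty set, so the series visits each member of [I]
    exactly once; disjointness of a family therefore survives the enumeration. *)
Lemma outer_measure_countable_cover (I : countType) (F : I -> set T) A :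
  A `<=` \bigcup_i F i ->
  mu A <= \sum_(j <oo) mu (oapp F set0 (pickle_inv j)).
Proof.
move=> AF; pose G j := oapp F set0 (@pickle_inv I j).
apply: (@le_trans _ _ (mu (\bigcup_j G j))).
  apply: le_outer_measure => x /AF[i _ Fi]; exists (pickle i) => //.
  by rewrite /G pickleK_inv.
exact: outer_measure_sigma_subadditive.
Qed.

End outer_measure_covers.

(** * Slabs over small sets *)

Lemma grid_index (R : realType) (p : nat) (h x : R) :
  0 < h -> 0 <= x < p%:R * h -> exists c : 'I_p, c%:R * h <= x < c.+1%:R * h.
Proof.
move=> h0 /andP[x0 xp]; have xh0 : 0 <= x / h by rewrite divr_ge0// ltW.
have /andP[t1 t2] := truncn_itv xh0.
have tp : (Num.truncn (x / h) < p)%N.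
  by rewrite -(ltr_nat R) (le_lt_trans t1)// ltr_pdivrMr.
by exists (Ordinal tp); rewrite /= -ler_pdivlMr// -ltr_pdivrMr// t1.
Qed.

Section slab.
Context {R : realType} {n m : nat}.
Hypothesis mn : (m <= n)%N.

(** A piece whose coordinates vary by at most 2e has diameter at most (n + m) 2e, and there are N^m
    pieces with N e <= 2r, whence the factor 2^m. For e <= r, [slab_scale] bounds these
    diameters. *)
Definition slab_const : R := 2 ^+ m * alpha R n * (n + m)%:R ^+ n.
Definition slab_scale (r : R) : R := (n + m)%:R * (2 * r).

(* The m-dimensional factor, a cube of side 2r, is cut into cubes of side 2e. *)
Lemma hdelta_slab_small (e r : R) (w : 'rV[R]_m) (F : set 'rV[R]_n)
    (B : set 'rV[R]_(n + m)) : 0 < e -> e <= r ->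
  (forall x y, F x -> F y -> forall i, `|x 0 i - y 0 i| <= 2 * e) ->
  (forall y, B y -> F (lsubmx y) /\ forall j, `|rsubmx y 0 j - w 0 j| < r) ->
  (hdelta n (slab_scale r)%:E B <= (slab_const * r ^+ m * e ^+ (n - m))%:E)%E.
Proof.
move=> e0 er Fe BF; have r0 : 0 < r by exact: lt_le_trans er.
(* N > r/e, so N intervals of length 2e cover a side of length 2r, while N e <= r + e <= 2r. *)
set N := (Num.truncn (r / e)).+1.
have /andP[N1 N2] : N.-1%:R <= r / e < N%:R by apply: truncn_itv; rewrite divr_ge0 ?ltW.
have Ne : N%:R * e <= 2 * r.
  by move: N1; rewrite /N/= -natr1 mulrDl mul1r ler_pdivlMr// => N1; lra.
pose P (g : {ffun 'I_m -> 'I_N}) := B `&` [set y : 'rV[R]_(n + m) | forall j : 'I_m,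
  (g j)%:R * (2 * e) <= rsubmx y 0 j - w 0 j + r < (g j).+1%:R * (2 * e)].
have BP : B `<=` \bigcup_g P g.
  move=> y By; have [_ yw] := BF _ By.
  have /fin_all_exists[g hg] : forall j : 'I_m, exists c : 'I_N,
      c%:R * (2 * e) <= rsubmx y 0 j - w 0 j + r < c.+1%:R * (2 * e).
    move=> j; apply: grid_index; first by rewrite mulr_gt0.
    move: (yw j); rewrite ltr_norml => /andP[y1 y2].
    apply/andP; split; first by lra.
    rewrite ltr_pdivrMr// in N2.
    by lra.
  by exists (finfun g) => //; split => // j; rewrite ffunE.
have Pe g : (hdelta n (slab_scale r)%:E (P g) <=
             (alpha R n * ((n + m)%:R * e) ^+ n)%:E)%E.
  apply: le_trans (hdelta_le_hterm _ _ _) _.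
  rewrite (_ : (n + m)%:R * e = (n + m)%:R * (2 * e) / 2); last by field.
  apply: hterm_le.
  - by rewrite mulr_ge0// mulr_ge0// ltW.
  - apply: diam_le => x y [Bx xg] [By yg]; rewrite lee_fin.
    apply: enorm_le_coord => [|i]; first by rewrite mulr_ge0// ltW.
    rewrite !mxE; case: (split_ordP i) => j ->.
      have := Fe _ _ (BF _ Bx).1 (BF _ By).1 j.
      by rewrite !mxE.
    have /andP[] := xg j; have /andP[] := yg j; rewrite !mxE -natr1 => y1 y2 x1 x2.
    by rewrite ler_norml; apply/andP; split; lra.
  - by rewrite lee_fin ler_wpM2l// ler_wpM2l.
apply: le_trans (outer_measure_fin_cover BP Pe) _.
rewrite -EFinM lee_fin card_ffun !card_ord natrX /slab_const.
(* Here m <= n enters: the factor e^m is absorbed by the number of pieces through (N e)^m <=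
   (2r)^m. *)
have en : e ^+ n = e ^+ (n - m) * e ^+ m by rewrite -exprD subnK.
rewrite exprMn en.
rewrite (_ : _ * (alpha R n * _) =
  (N%:R * e) ^+ m * (alpha R n * (n + m)%:R ^+ n * e ^+ (n - m))); last first.
  by rewrite exprMn; ring.
rewrite (_ : 2 ^+ m * _ * _ * _ * _ =
  (2 * r) ^+ m * (alpha R n * (n + m)%:R ^+ n * e ^+ (n - m))); last first.
  by rewrite exprMn; ring.
rewrite ler_wpM2r//.
  apply: mulr_ge0; last by rewrite exprn_ge0// ltW.
  by apply: mulr_ge0; [exact/ltW/alpha_gt0|exact: exprn_ge0].
by rewrite lerXn2r ?nnegrE ?mulr_ge0 ?(ltW e0) ?(ltW r0).
Qed.

(** The division turns e^(n-m) into the term alpha (e/2)^(n-m) of a set of diameter e. *)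
Definition slab_content : R := slab_const * 2 ^+ (n - m) / alpha R (n - m).

Lemma slab_const_gt0 : (0 < n)%N -> 0 < slab_const.
Proof.
move=> n0; apply: mulr_gt0; last by rewrite exprn_gt0// ltr0n addn_gt0 n0.
by apply: mulr_gt0; [exact: exprn_gt0|exact: alpha_gt0].
Qed.

Lemma slab_content_gt0 : (0 < n)%N -> 0 < slab_content.
Proof.
by move=> n0; rewrite divr_gt0 ?alpha_gt0// mulr_gt0 ?exprn_gt0// slab_const_gt0.
Qed.

(* [F] is used at scale [e = diam F], capped at [r]; a set of diameter 0 has no
   such scale and is handled by letting [e] tend to 0 (or, when n = m, by taking
   [e = r], since then [hterm 0] is constant). *)
Lemma hdelta_slab (r : R) (w : 'rV[R]_m) (A F : set 'rV[R]_n)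
    (B : set 'rV[R]_(n + m)) : (0 < n)%N -> 0 < r ->
  (forall x y, A x -> A y -> forall i, `|x 0 i - y 0 i| <= 2 * r) ->
  (forall y, B y -> A (lsubmx y) /\ forall j, `|rsubmx y 0 j - w 0 j| < r) ->
  (forall y, B y -> F (lsubmx y)) ->
  (hdelta n (slab_scale r)%:E B <=
   (slab_content * r ^+ m)%:E * hterm (n - m) +oo F)%E.
Proof.
move=> n0 r0 Ar BA BF.
have [F0|nF] := pselect (F = set0); last have F0 := (neq_set0P F).1 nF.
  suff -> : B = set0 by rewrite outer_measure0 mule_ge0 ?hterm_ge0// lee_fin
    mulr_ge0 ?exprn_ge0 ?(ltW r0) ?(ltW (slab_content_gt0 n0)).
  by apply/seteqP; split => // y /BF; rewrite F0.
set q := (n - m)%N; have a0 := alpha_gt0 R q.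
have c0 := slab_content_gt0 n0.
have step e : 0 < e -> e <= r -> (forall x y, (F `&` A) x -> (F `&` A) y ->
      forall i, `|x 0 i - y 0 i| <= 2 * e) -> (e%:E <= diam F)%E ->
  (hdelta n (slab_scale r)%:E B <=
   (slab_content * r ^+ m)%:E * hterm (n - m) +oo F)%E.
  move=> e0 er FAe eF.
  have /le_trans-> // := hdelta_slab_small (w := w) e0 er FAe
    (fun y By => conj (conj (BF y By) (BA y By).1) (BA y By).2).
  apply: (@le_trans _ _ ((slab_content * r ^+ m)%:E * (alpha R q * (e / 2) ^+ q)%:E)%E).
    rewrite -EFinM lee_fin /slab_content le_eqVlt; apply/orP; left; apply/eqP.
    by rewrite expr_div_n -/q; field; rewrite !expf_neq0 ?gt_eqF.
  apply: lee_wpmul2l; last exact: (le_hterm q +oo%E (ltW e0) F0 eF).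
  by rewrite lee_fin mulr_ge0 ?exprn_ge0 ?(ltW r0) ?(ltW c0).
have [rF|Fr] := leP r%:E (diam F).
  by apply: (step r) => // x y [_ Ax] [_ Ay]; exact: Ar.
have Ffin : diam F \is a fin_num.
  by rewrite ge0_fin_numE ?diam_ge0// (lt_trans Fr)// ltry.
have := diam_ge0 F0; rewrite le_eqVlt => /orP[/eqP F00|].
  have small e : 0 < e -> e <= r ->
      (hdelta n (slab_scale r)%:E B <= (slab_const * r ^+ m * e ^+ q)%:E)%E.
    move=> e0 er; apply: (hdelta_slab_small (w := w) (F := F) e0 er) => [x y Fx Fy i|y By].
      have := enorm_le_diam Fx Fy; rewrite -F00 lee_fin => dF.
      have := coord_le_enorm (x - y) i; rewrite !mxE => xy.
      by apply: le_trans xy (le_trans dF _); rewrite mulr_ge0// ltW.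
    by split; [exact: BF|exact: (BA _ By).2].
  have sc0 : 0 < slab_const * r ^+ m by rewrite mulr_gt0 ?exprn_gt0 ?slab_const_gt0.
  have [q0|q0] := posnP q.
    have := @le_hterm _ _ q +oo%E F 0 (lexx _) F0; rewrite -F00 => /(_ (lexx _)).
    rewrite q0 expr0 mulr1 => h0.
    apply: (le_trans (small r r0 (lexx _))); rewrite q0.
    apply: (@le_trans _ _ ((slab_content * r ^+ m)%:E * (alpha R 0)%:E)%E).
      rewrite -EFinM lee_fin /slab_content -/q q0 !expr0 !mulr1.
      rewrite le_eqVlt; apply/orP; left; apply/eqP; field.
      by rewrite gt_eqF// alpha_gt0.
    apply: lee_wpmul2l => //.
    by rewrite lee_fin mulr_ge0 ?exprn_ge0 ?(ltW r0) ?(ltW c0).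
  apply: (@le_trans _ _ 0%E); last first.
    rewrite mule_ge0 ?hterm_ge0// lee_fin mulr_ge0 ?exprn_ge0 ?(ltW r0) ?(ltW c0)//.
  apply/lee_addgt0Pr => eps eps0; rewrite add0e.
  set K := slab_const * r ^+ m * r ^+ q.-1.
  have K0 : 0 < K by rewrite mulr_gt0 ?exprn_gt0.
  (* As q > 0 and e <= r, e^q <= r^(q-1) e, so the bound is at most K e <= eps. *)
  pose e := Num.min r (eps / K).
  have e0 : 0 < e by rewrite lt_min r0 divr_gt0.
  have er : e <= r by rewrite ge_min lexx.
  apply: (le_trans (small e e0 er)); rewrite lee_fin -(prednK q0) exprSr mulrA.
  apply: (@le_trans _ _ (K * e)).
    by rewrite !ler_wpM2r ?ler_wpM2l ?lerXn2r ?nnegrE ?(ltW e0) ?(ltW r0) ?(ltW sc0).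
  by rewrite mulrC -ler_pdivlMr// ge_min lexx orbT.
move=> d0; apply: (step (fine (diam F))).
- by rewrite fine_gt0// d0/= (lt_trans Fr)// ltry.
- by rewrite -lee_fin fineK// ltW.
- move=> x y [Fx _] [Fy _] i; have := enorm_le_diam Fx Fy.
  rewrite -[diam F]fineK// lee_fin => dF; have := coord_le_enorm (x - y) i.
  by rewrite !mxE; have := enorm_ge0 (x - y); lra.
- by rewrite fineK.
Qed.

(** Each member of a cover of [A] cuts out the part of [B] lying above it; [hdelta_slab] bounds
    these parts one by one, and they exhaust [B]. *)
Lemma hdelta_graph_content (r : R) (w : 'rV[R]_m) (A : set 'rV[R]_n)
    (B : set 'rV[R]_(n + m)) : (0 < n)%N -> 0 < r ->
  (forall x y, A x -> A y -> forall i, `|x 0 i - y 0 i| <= 2 * r) ->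
  (forall y, B y -> A (lsubmx y) /\ forall j, `|rsubmx y 0 j - w 0 j| < r) ->
  (hdelta n (slab_scale r)%:E B <=
   (slab_content * r ^+ m)%:E * hcontent (n - m) A)%E.
Proof.
move=> n0 r0 Ar BA; set c := slab_content * r ^+ m.
have c0 : 0 < c by rewrite mulr_gt0 ?exprn_gt0 ?slab_content_gt0.
rewrite -lee_pdivrMl//; apply: le_mu_ext_cover => F AF.
rewrite lee_pdivrMl// -nneseriesZl; last by move=> i _; exact: hterm_ge0.
pose Bi i := B `&` [set y | F i (lsubmx y)].
apply: (@le_trans _ _ (hdelta n (slab_scale r)%:E (\bigcup_i Bi i))).
  apply: le_outer_measure => y By; have [Ay _] := BA _ By.
  by have [i _ Fi] := AF _ Ay; exists i.
apply: le_trans (outer_measure_sigma_subadditive _ _) _.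
apply: lee_nneseries => [i _ _|i _]; first exact: outer_measure_ge0.
apply: (hdelta_slab (w := w) (A := A)) => // y [By Fy]; first exact: BA.
exact: Fy.
Qed.
End slab.

(** * Boxes and Lebesgue outer measure *)

Section lebesgue_boxes.
Context {R : realType} {k : nat}.
Implicit Types (a b : 'rV[R]_k).
Local Notation L := (@leb_outer R k).

Definition vol a b : R := \prod_i (b 0 i - a 0 i).

Lemma vol_ge0 a b : (forall i, a 0 i <= b 0 i) -> 0 <= vol a b.
Proof. by move=> ab; apply: prodr_ge0 => i _; rewrite subr_ge0. Qed.

Lemma leb_box_le a b : (forall i, a 0 i <= b 0 i) -> (L (box a b) <= (vol a b)%:E)%E.
Proof.
move=> ab; apply: le_trans (mu_ext_le_self (@boxvol0 R k) (@boxvol_ge0 R k) _) _.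
rewrite /boxvol; case: pselect => nF; first by rewrite lee_fin vol_ge0.
by apply: ereal_inf_lbound; exists (a, b).
Qed.

Lemma boxvol_approx (F : set (discr 'rV[R]_k)) (e : R) : (0 < k)%N -> 0 < e ->
  (boxvol F < +oo)%E -> exists ab : 'rV[R]_k * 'rV[R]_k,
  [/\ forall i, ab.1 0 i <= ab.2 0 i, F `<=` box ab.1 ab.2 &
      ((vol ab.1 ab.2)%:E <= boxvol F + e%:E)%E].
Proof.
move=> k0 e0 Foo.
have Ff : boxvol F \is a fin_num by rewrite ge0_fin_numE// boxvol_ge0.
move: Foo Ff; rewrite /boxvol; case: pselect => [F0|F0]/= Foo Ff.
  (* The degenerate box has volume 0 because k > 0; for k = 0 the empty product would be 1. *)
  exists (0, 0) => /=; split => //; first by rewrite F0.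
  rewrite /vol (bigD1 (Ordinal k0))//= subrr mul0r add0e lee_fin.
  exact: ltW.
have [_ [[a b] [ab Fab] <-] /ltW ?] := lb_ereal_inf_adherent e0 Ff.
by exists (a, b); split => //=; rewrite -Fab.
Qed.

Definition upd a (i : 'I_k) (c : R) : 'rV[R]_k :=
  \row_j (if j == i then c else a 0 j).

Definition halfspace (i : 'I_k) (c : R) : set 'rV[R]_k := [set x | x 0 i < c].

(* [c'] is [c] clamped to the side of the box, so that both halves are boxes. *)
Lemma leb_split (F : set (discr 'rV[R]_k)) i c :
  (L (F `&` (halfspace i c)) +
   L (F `&` ~` (halfspace i c)) <= boxvol F)%E.
Proof.
rewrite /boxvol; case: pselect => [F0|F0]/=.
  by rewrite F0 !set0I !outer_measure0 adde0.
apply: le_ereal_inf_tmp => _ [[a b] /= [ab ->] <-].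
pose c' := Num.max (a 0 i) (Num.min (b 0 i) c).
have ac : a 0 i <= c' by rewrite le_max lexx.
have cb : c' <= b 0 i by rewrite ge_max ab ge_min lexx.
have V : vol a b = vol a (upd b i c') + vol (upd a i c') b.
  rewrite /vol [LHS](bigD1 i)//= [X in _ = X + _](bigD1 i)//= [X in _ = _ + X](bigD1 i)//=.
  rewrite !mxE eqxx.
  rewrite [X in _ = _ * X + _](eq_bigr (fun j => b 0 j - a 0 j)); last first.
    by move=> j ji; rewrite !mxE (negbTE ji).
  rewrite [X in _ = _ + _ * X](eq_bigr (fun j => b 0 j - a 0 j)); last first.
    by move=> j ji; rewrite !mxE (negbTE ji).
  by ring.
rewrite [leRHS](_ : _ = (vol a b)%:E)// V EFinD; apply: leeD.
  apply: (@le_trans _ _ (L (box a (upd b i c')))).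
    apply: le_outer_measure => x [xab xc] j; have /andP[xa xb] := xab j.
    rewrite !mxE xa/=; case: eqP => // ji; subst j.
    by rewrite /c' lt_max lt_min xb xc orbT.
  by apply: leb_box_le => j; rewrite !mxE; case: eqP => // ->.
apply: (@le_trans _ _ (L (box (upd a i c') b))).
  apply: le_outer_measure => x [xab /negP]; rewrite -leNgt => xc j.
  have /andP[xa xb] := xab j.
  rewrite !mxE xb andbT; case: eqP => // ji; subst j.
  by rewrite /c' ge_max xa ge_min xc orbT.
by apply: leb_box_le => j; rewrite !mxE; case: eqP => // ->.
Qed.

(** Caratheodory's criterion: a coordinate hyperplane splits every covering box without increasing
    the total volume, so one cover of [X] serves both halves. *)
Lemma measurable_halfspace i c :
  measurable ((halfspace i c) : set (LebT R k)).
Proof.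
apply: le_caratheodory_measurable => X.
set H := halfspace i c.
apply: le_mu_ext_cover => F XF.
apply: (@le_trans _ _ (\sum_(j <oo) (L (F j `&` H) + L (F j `&` ~` H)))%E); last first.
  apply: lee_nneseries => [j _ _|j _]; last exact: leb_split.
  by apply: adde_ge0; exact: outer_measure_ge0.
rewrite nneseriesD; [|by move=> j _ _; exact: outer_measure_ge0..].
have sub G : (L (X `&` G) <= \sum_(j <oo) L (F j `&` G))%E.
  apply: le_trans (outer_measure_sigma_subadditive _ _).
  by apply: le_outer_measure => x [/XF[j _ Fj] Gx]; exists j.
by apply: leeD; exact: sub.
Qed.

Lemma measurable_box a b : measurable (box a b : set (LebT R k)).
Proof.
have -> : box a b = \bigcap_(i in [set: 'I_k])
    (halfspace i (b 0 i) `&` ~` halfspace i (a 0 i)).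
  apply/seteqP; split => x xab i.
    by have /andP[xa xb] := xab i; split => //=; apply/negP; rewrite -leNgt.
  by have [xb /negP] := xab i I; rewrite -leNgt => ->.
apply: fin_bigcap_measurable => // i _; apply: measurableI.
  exact: measurable_halfspace.
by apply: measurableC; exact: measurable_halfspace.
Qed.

Lemma measurable_coord i : measurable_fun setT ((fun x => x 0 i) : LebT R k -> R).
Proof.
apply: (measurability _ (RGenInftyO.measurableE R)) => //= _ [_ [c ->] <-].
rewrite setTI (_ : _ @^-1` _ = (halfspace i c)).
  exact: measurable_halfspace.
by apply/seteqP; split => x /=; rewrite in_itv.
Qed.

End lebesgue_boxes.

(** A finite product is continuous in d, so all sides of a box can be lengthened at arbitrarily
    small cost in volume. *)
Lemma prod_enlarge {R : realType} (I : Type) (s : seq I) (u : I -> R) (e : R) :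
  0 < e -> exists2 d : R, 0 < d & \prod_(i <- s) (u i + 2 * d) <= \prod_(i <- s) u i + e.
Proof.
move=> e0.
have : \prod_(i <- s) (u i + 2 * d) @[d --> 0^'+] --> \prod_(i <- s) u i.
  elim: s => [|i s ih].
    by rewrite big_nil; under eq_fun do rewrite big_nil; exact: cvg_cst.
  rewrite big_cons; under eq_fun do rewrite big_cons.
  apply: cvgM => //; rewrite -[X in _ --> X]addr0 -[X in u i + X](mulr0 2).
  apply: cvgD; first exact: cvg_cst.
  apply: cvgM; first exact: cvg_cst.
  exact: cvg_at_right_filter.
move=> /cvgr_le cvgP; near (0 : R)^'+ => d; exists d => //.
by near: d; apply: cvgP; rewrite ltrDl.
Unshelve. all: by end_near. Qed.

(** * Exhaustion of neighbourhoods of bounded measurable sets *)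

Section exhaustion.
Context {R : realType} {k : nat}.
Implicit Types (a b : 'rV[R]_k) (A W E : set 'rV[R]_k).
Local Notation L := (@leb_outer R k).

Definition widen_box a b (t : R) : set 'rV[R]_k :=
  box (a - const_mx t) (b + const_mx t).

Definition nbhd_in (s : R) A W : Prop :=
  forall x y : 'rV[R]_k, A x -> (forall i, `|y 0 i - x 0 i| < s) -> W y.

Lemma widen_box_nbhd a b (s t t' : R) :
  t + s <= t' -> nbhd_in s (widen_box a b t) (widen_box a b t').
Proof.
move=> tt' x y xab yx i; have := xab i; have := yx i; rewrite !mxE ltr_norml.
by move=> /andP[y1 y2] /andP[x1 x2]; apply/andP; split; lra.
Qed.

Lemma sub_widen_box a b (t t' : R) : t <= t' -> widen_box a b t `<=` widen_box a b t'.
Proof.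
move=> tt' x xab i; have := xab i; rewrite !mxE => /andP[x1 x2].
by apply/andP; split; lra.
Qed.

Lemma box_sub_widen a b (t : R) : 0 <= t -> box a b `<=` widen_box a b t.
Proof.
move=> tt' x xab i; have := xab i; rewrite !mxE => /andP[x1 x2].
by apply/andP; split; lra.
Qed.

(** Half of [e] pays for a near-optimal cover; the other half, spread geometrically over j, pays for
    representing each member by a box and for widening that box. *)
Lemma leb_enlarged_cover E (e : R) : (0 < k)%N -> 0 < e -> (L E < +oo)%E ->
  exists (a b : nat -> 'rV[R]_k) (d : nat -> R),
  [/\ forall j, 0 < d j, E `<=` \bigcup_j box (a j) (b j) &
   (L (\bigcup_j widen_box (a j) (b j) (d j)) <= L E + e%:E)%E].
Proof.
move=> k0 e0 Eoo; have e20 : 0 < e / 2 by rewrite divr_gt0.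
have [F EF sumF] := mu_ext_approx (@boxvol_ge0 R k) e20 Eoo.
have Foo j : (boxvol (F j) < +oo)%E.
  rewrite ltey; apply/eqP => Fj.
  have := @nneseries_pinfty _ (fun j => boxvol (F j)) xpredT j (fun _ _ => boxvol_ge0 _) isT Fj.
  move=> Soo; move: sumF; rewrite Soo leye_eq => /eqP.
  by apply/eqP; rewrite -ltey lte_add_pinfty// ltry.
have pw j : 0 < e / 2 / (2 ^ j.+1)%:R :> R by rewrite divr_gt0// ltr0n expn_gt0.
have step j : exists z : 'rV[R]_k * 'rV[R]_k * R,
  [/\ 0 < z.2, forall i, z.1.1 0 i <= z.1.2 0 i, F j `<=` box z.1.1 z.1.2 &
     ((vol (z.1.1 - const_mx z.2) (z.1.2 + const_mx z.2))%:E <=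
        boxvol (F j) + (e / 2 / (2 ^ j.+1)%:R)%:E)%E].
  set p := (X in (_ + X%:E)%E); have p20 : 0 < p / 2 by rewrite divr_gt0// pw.
  have [[a b] /= [ab Fab vab]] := boxvol_approx k0 p20 (Foo j).
  have [d d0 dv] := prod_enlarge (index_enum 'I_k) (fun i => b 0 i - a 0 i) p20.
  exists (a, b, d); split => //=.
  have -> : vol (a - const_mx d) (b + const_mx d) =
            \prod_i (b 0 i - a 0 i + 2 * d).
    by apply: eq_bigr => i _; rewrite !mxE; ring.
  apply: (@le_trans _ _ ((vol a b)%:E + (p / 2)%:E)%E); first by rewrite -EFinD lee_fin.
  by rewrite [in leRHS](splitr p) EFinD addeA leeD2r.
have [z zP] := choice step.
exists (fun j => (z j).1.1), (fun j => (z j).1.2), (fun j => (z j).2); split.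
- by move=> j; have [] := zP j.
- by move=> x /EF[j _ Fj]; exists j => //; have [_ _ + _] := zP j; exact.
apply: le_trans (outer_measure_sigma_subadditive _ _) _.
apply: (@le_trans _ _ (\sum_(j <oo) (boxvol (F j) + (e / 2 / (2 ^ j.+1)%:R)%:E))%E).
  apply: lee_nneseries => [j _ _|j _]; first exact: outer_measure_ge0.
  have [z0 zab _] := zP j; apply: le_trans; apply: leb_box_le => i.
  by rewrite !mxE; have := zab i; lra.
apply: le_trans (epsilon_trick _ _ _) _ => //.
- by move=> j; exact: boxvol_ge0.
- exact: ltW.
by rewrite [in leRHS](splitr e) EFinD addeA leeD2r.
Qed.

Lemma bounded_exhaustion E (M e : R) : (0 < k)%N -> 0 < e -> 0 <= M ->
  measurable (E : set (LebT R k)) -> E `<=` box (const_mx (- M)) (const_mx M) ->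
  exists U : nat -> set 'rV[R]_k,
  [/\ U 0%N = set0,
      forall j, measurable (U j : set (LebT R k)) /\
                exists2 s, 0 < s & nbhd_in s (U j) (U j.+1),
      E `<=` \bigcup_j U j,
      \bigcup_j U j `<=` box (const_mx (- (M + 1))) (const_mx (M + 1)) &
      (L (\bigcup_j U j `\` E) <= e%:E)%E].
Proof.
move=> k0 e0 M0 mE EM.
have Eoo : (L E < +oo)%E.
  apply: le_lt_trans (ltry _); apply: le_trans (le_outer_measure _ _ _ EM) _.
  by apply: leb_box_le => i; rewrite !mxE; lra.
have [a [b [d [d0 Eab Lab]]]] := leb_enlarged_cover k0 e0 Eoo.
(* [U N] is built from the first N boxes widened by the fraction t_N of their allowance, cut to a
   widened cube; t_N increases strictly from 0 to 1, which leaves room between successive sets. *)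
pose t N : R := 1 - N.+1%:R^-1.
have t0 N : 0 <= t N by rewrite subr_ge0 invf_le1 ?ltr0n// ler1n.
have t1 N : t N <= 1 by rewrite gerBl invr_ge0.
have tS N : t N < t N.+1 by rewrite ltrD2l ltrN2 ltf_pV2 ?posrE ?ltr0n// ltr_nat.
pose U N : set 'rV[R]_k := widen_box (const_mx (- M)) (const_mx M) (t N) `&`
  [set x | exists2 j, (j < N)%N & widen_box (a j) (b j) (d j * t N) x].
have Usub : \bigcup_j U j `<=` \bigcup_j widen_box (a j) (b j) (d j).
  move=> x [N _ [_ [j jN xj]]]; exists j => //; apply: sub_widen_box xj.
  by rewrite ler_piMr// ltW.
have EU : E `<=` \bigcup_j U j.
  move=> x Ex; have [j _ xj] := Eab x Ex; exists j.+1 => //; split.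
    by apply: box_sub_widen => //; exact: EM.
  by exists j => //; apply: box_sub_widen xj; rewrite mulr_ge0// ltW.
exists U; split => //.
- by apply/seteqP; split => // x [_ [j]].
- move=> N; split.
    apply: measurableI; first exact: measurable_box.
    rewrite (_ : [set x | _] =
      \bigcup_(j in [set j | (j < N)%N]) widen_box (a j) (b j) (d j * t N)).
      by apply: bigcup_measurable => j _; exact: measurable_box.
    by apply/seteqP; split => x [j jN xj]; exists j.
  (* Only finitely many boxes enter [U N], so their allowances have a common positive lower
     bound. *)
  have [c c0 cd] : exists2 c : R, 0 < c & forall j, (j < N)%N -> c <= d j.
    elim: N => [|N [c c0 ih]]; first by exists 1.
    exists (Num.min c (d N)); first by rewrite lt_min c0 d0.
    move=> j; rewrite ltnS leq_eqVlt => /predU1P[->|/ih cd]; first by rewrite ge_min lexx orbT.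
    by rewrite ge_min cd.
  exists (Num.min 1 c * (t N.+1 - t N)).
    by rewrite mulr_gt0 ?subr_gt0// lt_min c0 ltr01.
  have tt : 0 <= t N.+1 - t N by rewrite subr_ge0 ltW.
  move=> x y [xM [j jN xj]] xy; split.
    apply: widen_box_nbhd xM xy; rewrite -lerBrDl -[leRHS]mul1r ler_wpM2r//.
    by rewrite ge_min lexx.
  exists j; first exact: ltnW.
  apply: widen_box_nbhd xj xy; rewrite -lerBrDl -mulrBr ler_wpM2r//.
  by rewrite ge_min cd ?orbT.
- move=> x [N _ [xM _]] i; have := xM i; rewrite !mxE => /andP[x1 x2].
  by have t1N := t1 N; apply/andP; split; lra.
(* Measurability of [E] splits the measure of the union into that of [E] and that of the excess; the
   former is finite and cancels. *)
have := le_trans (le_outer_measure L _ _ Usub) Lab.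
rewrite (mE (\bigcup_j U j)) (_ : _ `&` E = E); last first.
  by apply/seteqP; split => [x []//|x Ex]; split => //; exact: EU.
by rewrite leeD2lE// ge0_fin_numE ?outer_measure_ge0.
Qed.

End exhaustion.

(** * Covering the graph *)

Section hausdorff_measure.
Context {R : realType} {k : nat} (q : nat).
Local Open Scope ereal_scope.

Lemma le_hdelta (d d' : \bar R) (A : set 'rV[R]_k) :
  d' <= d -> hdelta q d A <= hdelta q d' A.
Proof.
move=> dd; apply: le_mu_ext_cover => F AF.
apply: (@le_trans _ _ (\sum_(i <oo) hterm q d (F i))).
  by apply: ereal_inf_lbound; exists F.
apply: lee_nneseries => [i _ _|i _]; first exact: hterm_ge0.
rewrite /hterm; case: pselect => [//|nF]; case: ifPn => [dF|_].
  by rewrite (le_lt_trans dd dF).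
case: ifPn => // _; exact: leey.
Qed.

Lemma hdelta_le_hmeasure (d : R) (A : set 'rV[R]_k) :
  (0 < d)%R -> hdelta q d%:E A <= hmeasure q A.
Proof.
by move=> d0; apply: ereal_sup_ubound; exists d => //=; rewrite in_itv/= d0.
Qed.

Lemma hmeasure_le (c : \bar R) (A : set 'rV[R]_k) :
  (forall d : R, (0 < d)%R -> hdelta q d%:E A <= c) -> hmeasure q A <= c.
Proof.
move=> h; apply: ge_ereal_sup => _ [d /= + <-]; rewrite in_itv/= andbT.
exact: h.
Qed.

Lemma hmeasure_ge0 (A : set 'rV[R]_k) : 0 <= hmeasure q A.
Proof. exact: le_trans (outer_measure_ge0 _ _) (hdelta_le_hmeasure _ (ltr01)). Qed.

Lemma sub_hmeasure (A B : set 'rV[R]_k) : A `<=` B -> hmeasure q A <= hmeasure q B.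
Proof.
move=> AB; apply: hmeasure_le => d d0; apply: le_trans (hdelta_le_hmeasure _ d0).
exact: le_outer_measure.
Qed.

Lemma hmeasure_bigcup (F : nat -> set 'rV[R]_k) :
  hmeasure q (\bigcup_i F i) <= \sum_(i <oo) hmeasure q (F i).
Proof.
apply: hmeasure_le => d d0.
apply: le_trans (outer_measure_sigma_subadditive _ _) _.
apply: lee_nneseries => [i _ _|i _]; first exact: outer_measure_ge0.
exact: hdelta_le_hmeasure.
Qed.

End hausdorff_measure.

Lemma sum_measure_le d (T : measurableType d) (R : realType)
    (nu : {measure set T -> \bar R}) (F : nat -> set T) (W : set T) :
  (forall j, measurable (F j)) -> trivIset setT F -> measurable W ->
  (forall j, F j `<=` W) -> (\sum_(j <oo) nu (F j) <= nu W)%E.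
Proof.
move=> mF tF mW FW; have mU : measurable (\bigcup_j F j) by exact: bigcup_measurable.
rewrite (cvg_lim _ (measure_semi_sigma_additive F mF tF mU))//.
apply: le_measure; rewrite ?inE//.
by move=> x [j _ /FW].
Qed.

Section graph_cover.
Context {R : realType} {n m : nat}.
Hypotheses (mn : (m <= n)%N) (n0 : (0 < n)%N).
Variable f : 'rV[R]_n -> 'rV[R]_m.
Hypothesis mf : forall j, measurable_fun setT ((fun x => f x 0 j) : LebT R n -> R).
Let k := (n + m)%N.

Definition graph_ball (z : 'rV[R]_(n + m)) (r : R) : set 'rV[R]_n :=
  [set x | enorm (fbar f x - z) < r].

(** The projection inverts the graph map, so the sets in the hypothesis are preimages of balls, and
    hence measurable. *)
Lemma proj_graph_ball z r :
  @projn R n m @` (range (fbar f) `&` eball z r) = graph_ball z r.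
Proof.
apply/seteqP; split => [_ [_ [[x _ <-] xz] <-]|x xz].
  by rewrite /projn row_mxKl.
by exists (fbar f x); [split => //; exists x|rewrite /projn row_mxKl].
Qed.

Lemma measurable_fbar i :
  measurable_fun setT ((fun x => fbar f x 0 i) : LebT R n -> R).
Proof.
case: (split_ordP i) => j ->.
  rewrite [X in measurable_fun _ X](_ : _ = (fun x : 'rV[R]_n => x 0 j)); first exact: measurable_coord.
  by apply/funext => x; rewrite /fbar row_mxEl.
rewrite [X in measurable_fun _ X](_ : _ = (fun x : 'rV[R]_n => f x 0 j)); first exact: mf.
by apply/funext => x; rewrite /fbar row_mxEr.
Qed.

Lemma measurable_graph_ball z r : measurable (graph_ball z r : set (LebT R n)).
Proof.
pose g : LebT R n -> R := fun x => \sum_i (fbar f x - z) 0 i ^+ 2.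
have mg : measurable_fun setT g.
  apply: measurable_sum => i; apply: measurable_funX.
  rewrite [X in measurable_fun _ X](_ : _ = (fun x : 'rV[R]_n => fbar f x 0 i - z 0 i)); last first.
    by apply/funext => x; rewrite coordB.
  by apply: measurable_funB => //; exact: measurable_fbar.
have ms : measurable_fun setT (Num.sqrt \o g).
  apply: measurableT_comp => //.
  by apply: continuous_measurable_fun; exact: sqrt_continuous.
rewrite (_ : graph_ball z r = setT `&` (Num.sqrt \o g) @^-1` `]-oo, r[).
  exact: ms.
by apply/seteqP; split => x /=; rewrite in_itv/=; [|case].
Qed.

Lemma graph_ball_coord z r x i : graph_ball z r x -> `|fbar f x 0 i - z 0 i| < r.
Proof.
move=> /(le_lt_trans (coord_le_enorm (fbar f x - z) i)).
by rewrite coordB.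
Qed.

Variable nu : {measure set (LebT R n) -> \bar R}.
Hypothesis content_nu : forall z r, 0 < r ->
  (hcontent (n - m) (graph_ball z r) <= (r ^- m)%:E * nu (graph_ball z (4 * r)))%E.

(** The factor r^m of the slab estimate cancels the r^-m of the hypothesis. *)
Lemma hdelta_graph_ball z r : 0 < r ->
  (hdelta n (slab_scale (n := n) (m := m) r)%:E (fbar f @` graph_ball z r) <=
   (@slab_content R n m)%:E * nu (graph_ball z (4 * r)))%E.
Proof.
move=> r0; set c := @slab_content R n m.
have c0 : 0 < c by exact: slab_content_gt0.
apply: (@le_trans _ _ ((c * r ^+ m)%:E * hcontent (n - m) (graph_ball z r))%E).
  apply: (hdelta_graph_content mn (w := rsubmx z)) => // [x y xz yz i|_ [x xz <-]].
    have := graph_ball_coord (lshift m i) xz; have := graph_ball_coord (lshift m i) yz.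
    rewrite /fbar !row_mxEl !ltr_norml ler_norml => /andP[y1 y2] /andP[x1 x2].
    by apply/andP; split; lra.
  rewrite row_mxKl; split => // j.
  by have := graph_ball_coord (rshift n j) xz; rewrite row_mxKr /fbar row_mxEr !mxE.
rewrite EFinM -muleA; apply: lee_wpmul2l; first by rewrite lee_fin ltW.
apply: (@le_trans _ _ ((r ^+ m)%:E * ((r ^- m)%:E * nu (graph_ball z (4 * r))))%E).
  by apply: lee_wpmul2l (content_nu _ _); rewrite // lee_fin exprn_ge0// ltW.
by rewrite muleA -EFinM divff ?mul1e// expf_neq0// gt_eqF.
Qed.

(** The mesh will be h = r/(2k), so that p h = 8r; p^k is the number of residue classes. *)
Let p := (16 * k)%N.
Definition cover_const : R := (p ^ k)%N%:R * @slab_content R n m.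

Lemma cover_const_gt0 : 0 < cover_const.
Proof.
by rewrite mulr_gt0 ?slab_content_gt0// ltr0n expn_gt0 /p muln_gt0 /k addn_gt0 n0.
Qed.

(* The lattice h Z^k is split into the residue classes [c] modulo [p]; within one
   class the balls of radius 4 r are disjoint because p h = 8 r. *)
Let node (h : R) (c : {ffun 'I_k -> 'I_p}) (l : {ffun 'I_k -> int}) : 'rV[R]_k :=
  \row_i (h * ((c i)%:R + p%:R * (l i)%:~R)).

Let cell (h : R) (z : 'rV[R]_k) : set 'rV[R]_k :=
  [set y | forall i, z 0 i <= y 0 i < z 0 i + h].

Let cell_cover (h : R) (y : 'rV[R]_k) : 0 < h -> exists c l, cell h (node h c l) y.
Proof.
move=> h0; have k0 : (0 < k)%N by rewrite /k addn_gt0 n0.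
have p0 : 0 < p%:R :> R by rewrite ltr0n /p muln_gt0.
have /fin_all_exists[g gP] : forall i, exists cl : 'I_p * int,
    h * (cl.1%:R + p%:R * cl.2%:~R) <= y 0 i < h * (cl.1%:R + p%:R * cl.2%:~R) + h.
  (* Division by p h: [l] is the quotient, and the remainder, divided by h, gives the residue
     [c]. *)
  move=> i; pose l := Num.floor (y 0 i / (p%:R * h)).
  have ph : 0 < p%:R * h by rewrite mulr_gt0.
  have /andP[l1 l2] : l%:~R <= y 0 i / (p%:R * h) < (l + 1)%:~R by exact: floor_itv.
  rewrite ler_pdivlMr// in l1; rewrite ltr_pdivrMr// intrD in l2.
  have [|c /andP[c1 c2]] := @grid_index R p h (y 0 i - l%:~R * (p%:R * h)) h0.
    by apply/andP; split; lra.
  exists (c, l) => /=; rewrite -natr1 in c2.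
  by apply/andP; split; lra.
exists [ffun i => (g i).1], [ffun i => (g i).2] => i.
by rewrite !mxE !ffunE.
Qed.

(** Within one residue class the balls of radius 4r are disjoint and their preimages lie in [W], so
    each class contributes at most [nu W] up to the slab constant. *)
Lemma hdelta_graph_nbhd (A W : set 'rV[R]_n) (s d : R) :
  0 < s -> 0 < d -> measurable (W : set (LebT R n)) -> nbhd_in s A W ->
  (hdelta n d%:E (fbar f @` A) <= cover_const%:E * nu W)%E.
Proof.
move=> s0 d0 mW AW; have k0 : (0 < k)%N by rewrite /k addn_gt0 n0.
have kR : 0 < k%:R :> R by rewrite ltr0n.
(* The first bound gives pieces of diameter at most [d]. The second gives 5r < s: a node is within r
   of a graph point over [A], and the dilated ball has radius 4r. *)
pose r : R := Num.min (d / (2 * k%:R)) (s / 6).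
have r0 : 0 < r by rewrite lt_min !divr_gt0// mulr_gt0.
have rd : slab_scale (n := n) (m := m) r <= d.
  rewrite /slab_scale -/k mulrA -ler_pdivlMl ?mulr_gt0// ge_min.
  by rewrite (mulrC _^-1) (mulrC k%:R) lexx.
have rs : 5 * r < s.
  have : r <= s / 6 by rewrite ge_min lexx orbT.
  by move=> ?; lra.
pose h := r / (2 * k%:R).
have h0 : 0 < h by rewrite divr_gt0// mulr_gt0.
have hk : k%:R * h = r / 2 by rewrite /h; field; rewrite gt_eqF.
(* Nodes whose cell misses the graph over [A] are discarded; their dilated balls need not lie over
   [W]. *)
pose near c l := exists2 x, A x & cell h (node h c l) (fbar f x).
pose G c l : set 'rV[R]_k :=
  [set y | near c l /\ (fbar f @` graph_ball (node h c l) r) y].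
pose G4 c l : set 'rV[R]_n := [set x | near c l /\ graph_ball (node h c l) (4 * r) x].
have cellball c l x : cell h (node h c l) (fbar f x) -> graph_ball (node h c l) r x.
  move=> cx; apply: (@le_lt_trans _ _ (k%:R * h)); last by rewrite hk; lra.
  apply: enorm_le_coord => [|i]; first exact: ltW.
  have /andP[x1 x2] := cx i; rewrite coordB ler_norml.
  by apply/andP; split; lra.
have mG4 c l : measurable (G4 c l : set (LebT R n)).
  have [nc|nc] := pselect (near c l).
    rewrite (_ : G4 c l = graph_ball (node h c l) (4 * r)).
      exact: measurable_graph_ball.
    by apply/seteqP; split => x //; case.
  by rewrite (_ : G4 c l = set0)//; apply/seteqP; split => x // [].
have G4W c l : G4 c l `<=` W.
  move=> x [[x' Ax' /cellball x'z] xz]; apply: (AW x') => // i.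
  have := graph_ball_coord (lshift m i) xz; have := graph_ball_coord (lshift m i) x'z.
  rewrite /fbar !row_mxEl !ltr_norml => /andP[y1 y2] /andP[x1 x2].
  by apply/andP; split; lra.
have GG4 c l : (hdelta n d%:E (G c l) <= (@slab_content R n m)%:E * nu (G4 c l))%E.
  have [nc|nc] := pselect (near c l).
    apply: (@le_trans _ _ (hdelta n d%:E (fbar f @` graph_ball (node h c l) r))).
      by apply: le_outer_measure => y [].
    rewrite (_ : G4 c l = graph_ball (node h c l) (4 * r)); last first.
      by apply/seteqP; split => x //; case.
    apply: le_trans (hdelta_graph_ball _ r0); apply: le_hdelta.
    by rewrite lee_fin.
  rewrite (_ : G c l = set0) ?outer_measure0; last by apply/seteqP; split => x // [].
  by rewrite mule_ge0// lee_fin ltW// slab_content_gt0.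
have AG : fbar f @` A `<=` \bigcup_c \bigcup_l G c l.
  move=> _ [x Ax <-]; have [c [l cl]] := cell_cover (fbar f x) h0.
  exists c => //; exists l => //; split; first by exists x.
  by exists x => //; exact: cellball.
have cls c : (hdelta n d%:E (\bigcup_l G c l) <= (@slab_content R n m)%:E * nu W)%E.
  apply: le_trans (outer_measure_countable_cover _ (@subset_refl _ _)) _.
  pose G4' j := oapp (G4 c) set0 (@pickle_inv {ffun 'I_k -> int} j).
  apply: (@le_trans _ _ (\sum_(j <oo) (@slab_content R n m)%:E * nu (G4' j))%E).
    apply: lee_nneseries => [j _ _|j _]; first exact: outer_measure_ge0.
    rewrite /G4'; case: pickle_inv => [l|] /=; first exact: GG4.
    by rewrite outer_measure0 measure0 mule0.
  rewrite nneseriesZl; last by move=> j _; exact: measure_ge0.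
  apply: lee_wpmul2l; first by rewrite lee_fin ltW// slab_content_gt0.
  apply: sum_measure_le => //.
  - by move=> j; rewrite /G4'; case: pickle_inv => [l|] /=; [exact: mG4|].
  - apply/trivIsetP => i j _ _ /eqP ij; apply/seteqP; split => // x [].
    rewrite /G4'; have := @pickle_invK {ffun 'I_k -> int} i.
    have := @pickle_invK {ffun 'I_k -> int} j.
    case: pickle_inv => [l|//] /= lj; case: pickle_inv => [l'|//] /= li [_ xl'] [_ xl].
    apply: ij; rewrite -lj -li; congr pickle; apply/ffunP => a.
    have := graph_ball_coord a xl; have := graph_ball_coord a xl'.
    rewrite !mxE !ltr_norml => /andP[y1 y2] /andP[x1 x2].
    (* A common point puts two nodes less than 8r apart in each coordinate, while nodes of one class
       differ there by multiples of p h = 8r. *)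
    have hp : h * p%:R = 8 * r by rewrite /p natrM mulrCA (mulrC h) hk; lra.
    have e1 : (l' a)%:~R < (l a)%:~R + 1 :> R.
      rewrite -(ltr_pM2l (_ : 0 < 8 * r)) ?mulr_gt0// -hp.
      by lra.
    have e2 : (l a)%:~R < (l' a)%:~R + 1 :> R.
      rewrite -(ltr_pM2l (_ : 0 < 8 * r)) ?mulr_gt0// -hp.
      by lra.
    move: e1 e2; rewrite -!(intrD _ _ 1) !ltr_int; lia.
  - by move=> j; rewrite /G4'; case: pickle_inv => [l|] //=; exact: G4W.
apply: le_trans (outer_measure_fin_cover AG cls) _.
by rewrite card_ffun !card_ord muleA -EFinM.
Qed.

Lemma hmeasure_graph_nbhd (A W : set 'rV[R]_n) (s : R) :
  0 < s -> measurable (W : set (LebT R n)) -> nbhd_in s A W ->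
  (hmeasure n (fbar f @` A) <= cover_const%:E * nu W)%E.
Proof.
by move=> s0 mW AW; apply: hmeasure_le => d d0; exact: hdelta_graph_nbhd mW AW.
Qed.

(** The layer U_{j+1} \ U_j has a uniform neighbourhood inside U_{j+2} \ U_{j-1}, a union of three
    consecutive layers; each layer is thus counted at most three times. *)
Lemma hmeasure_graph_exhaustion (U : nat -> set 'rV[R]_n) :
  U 0%N = set0 ->
  (forall j, measurable (U j : set (LebT R n)) /\
             exists2 s, 0 < s & nbhd_in s (U j) (U j.+1)) ->
  (hmeasure n (fbar f @` (\bigcup_j U j)) <=
   (3 * cover_const)%:E * nu (\bigcup_j U j))%E.
Proof.
move=> U0 UP; have c0 := cover_const_gt0.
have mU j : measurable (U j : set (LebT R n)) by case: (UP j).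
have US j : U j `<=` U j.+1.
  have [_ [s s0 Us]] := UP j; move=> x Ux; apply: (Us x) => // i.
  by rewrite subrr normr0.
have Umono i j : (i <= j)%N -> U i `<=` U j.
  move=> ij; rewrite -(subnK ij); elim: (j - i)%N => //= l ih.
  by rewrite addSn; exact: subset_trans (US _).
(* [D' j] is the layer before [D j], empty for j = 0; correspondingly [U j.-1] is then [U 0], the
   empty set. *)
pose D j := U j.+1 `\` U j; pose D' j := if j is l.+1 then D l else set0.
have mD j : measurable (D j : set (LebT R n)) by exact: measurableD.
have mD' j : measurable (D' j : set (LebT R n)) by case: j => [|j] /=.
have mUU : measurable (\bigcup_j U j : set (LebT R n)) by exact: bigcup_measurable.
have DU j : D j `<=` \bigcup_j U j by move=> x [Ux _]; exists j.+1.
have tD : trivIset setT D.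
  apply: ltn_trivIset => i j ij; apply/seteqP; split => // x [[Uj _] [_ nUi]].
  by apply: nUi; exact: (Umono _ _ ij _ Uj).
have tD1 : trivIset setT (fun j => D j.+1).
  by apply/trivIsetP => i j _ _ ij; move/trivIsetP : tD; apply.
have tD' : trivIset setT D'.
  apply/trivIsetP => -[|i] [|j] _ _ ij //=; rewrite ?set0I ?setI0//.
  by move/trivIsetP : tD; apply.
have UD : fbar f @` (\bigcup_j U j) `<=` \bigcup_j (fbar f @` D j).
  move=> _ [x [j _ Ujx] <-].
  have [l [lx nlx]] : exists l, U l.+1 x /\ ~ U l x.
    elim: j Ujx => [|j ih Uj]; first by rewrite U0.
    by have [/ih//|nUj] := pselect (U j x); exists j.
  by exists l => //; exists x.
have step j : (hmeasure n (fbar f @` D j) <=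
    cover_const%:E * (nu (D j.+1) + nu (D j) + nu (D' j)))%E.
  have [_ [s1 s10 Us1]] := UP j.+1; have [_ [s2 s20 Us2]] := UP j.-1.
  apply: (@le_trans _ _ (cover_const%:E * nu (U j.+2 `\` U j.-1))%E).
    apply: (@hmeasure_graph_nbhd _ _ (Num.min s1 s2)); first by rewrite lt_min s10.
      exact: measurableD.
    move=> x y [Ux nUx] yx; split.
      by apply: (Us1 x) => // i; apply: lt_le_trans (yx i) _; rewrite ge_min lexx.
    (* If y were in U_{j-1}, the point x, being close to y, would lie in U_j. *)
    move=> Uy; apply: nUx; have := Us2 y x Uy; case: j Ux Uy {Us1 Us2 UP} => [|j] Ux Uy h /=.
      by move: Uy; rewrite U0.
    apply: h => i; rewrite distrC; apply: lt_le_trans (yx i) _.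
    by rewrite ge_min lexx orbT.
  apply: lee_wpmul2l; first by rewrite lee_fin ltW.
  apply: (@le_trans _ _ (nu (D j.+1 `|` D j `|` D' j))).
    apply: le_measure; rewrite ?inE; [exact: measurableD|by apply: measurableU => //; exact: measurableU|].
    move=> x [U2 U1]; have [Ux1|nU1] := pselect (U j.+1 x); last by left; left.
    have [Ux|nUx] := pselect (U j x); last by left; right.
    by right; case: j U1 Ux {U2 Ux1 Us1 Us2} => [|j].
  apply: le_trans (measureU2 _ _ _) _ => //; first exact: measurableU.
  by apply: leeD => //; exact: measureU2.
apply: le_trans (sub_hmeasure _ UD) _.
apply: le_trans (hmeasure_bigcup _ _) _.
apply: (@le_trans _ _ (\sum_(j <oo)
  cover_const%:E * (nu (D j.+1) + nu (D j) + nu (D' j)))%E).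
  apply: lee_nneseries => [j _ _|j _]; [exact: hmeasure_ge0|exact: step].
rewrite nneseriesZl; last by move=> j _; rewrite !adde_ge0.
rewrite [in leRHS]mulrC [in leRHS]EFinM -muleA.
apply: lee_wpmul2l; first by rewrite lee_fin ltW.
rewrite nneseriesD; [|by move=> j _ _; rewrite ?adde_ge0..].
rewrite nneseriesD; [|by move=> j _ _; rewrite ?adde_ge0..].
rewrite (_ : 3%:E = 1 + 1 + 1)%E; last by rewrite -!EFinD; congr EFin; ring.
rewrite ge0_muleDl ?adde_ge0 ?lee01// ge0_muleDl ?lee01// !mul1e.
apply: leeD; [apply: leeD|]; apply: sum_measure_le => // -[|j] /=; first [exact: DU|exact: sub0set].
Qed.

(** * From exhaustions to arbitrary measurable sets *)

Hypothesis nu_cont : forall M e : R, 0 < M -> 0 < e -> exists2 d : R, 0 < d &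
  forall A : set (LebT R n), measurable A -> A `<=` box (const_mx (- M)) (const_mx M) ->
    (@lebn R n A <= d%:E)%E -> (nu A <= e%:E)%E.

Lemma hmeasure_graph_bounded (M : R) (E : set 'rV[R]_n) : 0 <= M ->
  measurable (E : set (LebT R n)) -> E `<=` box (const_mx (- M)) (const_mx M) ->
  (hmeasure n (fbar f @` E) <= (3 * cover_const)%:E * nu E)%E.
Proof.
move=> M0 mE EM; have c0 : 0 < 3 * cover_const by rewrite mulr_gt0// cover_const_gt0.
apply/lee_addgt0Pr => e e0.
(* The exhausting sets leave the given cube but stay in the one of half-side M + 1; the tolerance is
   divided by the final constant. *)
have M1 : 0 < M + 1 by rewrite ltr_wpDl.
have ec : 0 < e / (3 * cover_const) by rewrite divr_gt0.
have [d d0 dP] := nu_cont M1 ec.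
have [U [U0 UP EU UM Ud]] := bounded_exhaustion n0 d0 M0 mE EM.
have mU : measurable (\bigcup_j U j : set (LebT R n)).
  by apply: bigcup_measurable => j _; have [] := UP j.
apply: (@le_trans _ _ (hmeasure n (fbar f @` (\bigcup_j U j)))).
  by apply: sub_hmeasure; exact: image_subset.
apply: le_trans (hmeasure_graph_exhaustion U0 UP) _.
apply: (@le_trans _ _ ((3 * cover_const)%:E * (nu E + (e / (3 * cover_const))%:E))%E).
  apply: lee_wpmul2l; first by rewrite lee_fin ltW.
  apply: (@le_trans _ _ (nu E + nu (\bigcup_j U j `\` E))%E).
    rewrite -{1}(setDUK EU); apply: measureU2 => //; exact: measurableD.
  rewrite leeD2l//; apply: dP => //; first exact: measurableD.
  by apply: subset_trans UM => x [].
rewrite ge0_muleDr//; last by rewrite lee_fin ltW.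
by rewrite -EFinM (mulrC _ (e / _)) divfK// gt_eqF.
Qed.

Lemma hmeasure_graph (E : set 'rV[R]_n) : measurable (E : set (LebT R n)) ->
  (hmeasure n (fbar f @` E) <= (3 * cover_const)%:E * nu E)%E.
Proof.
move=> mE; have c0 : 0 < 3 * cover_const by rewrite mulr_gt0// cover_const_gt0.
pose B N : set 'rV[R]_n := box (const_mx (- N%:R)) (const_mx N%:R).
pose D N := E `&` (B N.+1 `\` B N).
have mB N : measurable (B N : set (LebT R n)) by exact: measurable_box.
have mD N : measurable (D N : set (LebT R n)).
  by apply: measurableI => //; exact: measurableD.
have Bmono i j : (i <= j)%N -> B i `<=` B j.
  move=> ij x xB l; have := xB l; rewrite !mxE => /andP[x1 x2].
  have ijR : i%:R <= j%:R :> R by rewrite ler_nat.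
  by apply/andP; split; lra.
have ED : E `<=` \bigcup_N D N.
  move=> x Ex; have [N BN] : exists N, B N x.
    exists (Num.truncn (\sum_i `|x 0 i|)).+1 => i; rewrite !mxE.
    have S0 : 0 <= \sum_i `|x 0 i| by exact: sumr_ge0.
    have /andP[_ t2] := truncn_itv S0.
    have : `|x 0 i| <= \sum_i `|x 0 i|.
      by rewrite (bigD1 i)//= lerDl; exact: sumr_ge0.
    move=> /le_lt_trans/(_ t2); rewrite ltr_norml => /andP[y1 y2].
    by rewrite y2 ltW.
  (* The induction starts because the half-open cube [B 0] is empty when n > 0. *)
  have [l [lx nlx]] : exists l, B l.+1 x /\ ~ B l x.
    elim: N BN => [|N ih BN].
      by move=> /(_ (Ordinal n0)); rewrite !mxE oppr0 => /andP[x1 x2]; lra.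
    by have [/ih//|nB] := pselect (B N x); exists N.
  by exists l.
apply: (@le_trans _ _ (hmeasure n (\bigcup_N (fbar f @` D N)))).
  by rewrite -image_bigcup; apply: sub_hmeasure; exact: image_subset.
apply: le_trans (hmeasure_bigcup _ _) _.
apply: (@le_trans _ _ (\sum_(N <oo) (3 * cover_const)%:E * nu (D N))%E).
  apply: lee_nneseries => [N _ _|N _]; first exact: hmeasure_ge0.
  by apply: (@hmeasure_graph_bounded N.+1%:R) => // x [_ []].
rewrite nneseriesZl; last by move=> j _; exact: measure_ge0.
apply: lee_wpmul2l; first by rewrite lee_fin ltW.
apply: sum_measure_le => //; last by move=> N x [].
apply: ltn_trivIset => i j ij; apply/seteqP; split => // x [[_ [Bj _]] [_ [_ nBi]]].
by apply: nBi; exact: (Bmono _ _ ij _ Bj).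
Qed.

End graph_cover.

(** * Positivity of the density *)

(** The projection lies in a cube of side 2e for every e larger than the diameter, which is finite
    because a finite term at scale 1 forces it to be at most 1. *)
Lemma leb_proj_le {R : realType} (n m : nat) (F : set 'rV[R]_(n + m)) : (0 < n)%N ->
  (@leb_outer R n (@projn R n m @` F) <= (8 ^+ n / alpha R n)%:E * hterm n 1 F)%E.
Proof.
move=> n0; have a0 := alpha_gt0 R n.
have K0 : 0 < 8 ^+ n / alpha R n by rewrite divr_gt0// exprn_gt0.
have [F0|nF] := pselect (F = set0).
  by rewrite F0 image_set0 outer_measure0 hterm0 mule0.
have F0 := (neq_set0P F).1 nF.
have [hF|hF] := pselect (hterm n 1 F < +oo)%E; last first.
  suff -> : hterm n 1 F = +oo%E by rewrite gt0_muley ?leey// lte_fin.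
  by apply/eqP; rewrite -leye_eq leNgt; apply/negP.
have dF1 := hterm_gt_diam F0 hF.
have dFin : diam F \is a fin_num.
  by rewrite ge0_fin_numE ?diam_ge0// (le_lt_trans dF1)// ltry.
set d := fine (diam F); have dE : diam F = d%:E by rewrite fineK.
have d0 : 0 <= d by rewrite -lee_fin -dE diam_ge0.
have [z Fz] := F0.
have small e : d < e -> (@leb_outer R n (@projn R n m @` F) <= ((2 * e) ^+ n)%:E)%E.
  move=> de; pose x0 := @projn R n m z.
  apply: (@le_trans _ _ (@leb_outer R n (box (x0 - const_mx e) (x0 + const_mx e)))).
    apply: le_outer_measure => _ [y Fy <-] i.
    have := enorm_le_diam Fy Fz; rewrite dE lee_fin => yz.
    have := coord_le_enorm (y - z) (lshift m i); rewrite coordB.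
    rewrite coordB mxE /x0 /projn !mxE => /le_trans/(_ yz)/le_lt_trans/(_ de).
    rewrite ltr_norml => /andP[y1 y2].
    by apply/andP; split; lra.
  apply: le_trans (leb_box_le _) _.
    by move=> i; rewrite !mxE; lra.
  rewrite lee_fin /vol (eq_bigr (fun=> 2 * e)).
    by rewrite prodr_const card_ord.
  by move=> i _; rewrite !mxE; ring.
move: d0; rewrite le_eqVlt => /predU1P[d0|d0].
  apply: (@le_trans _ _ 0%E); last by rewrite mule_ge0 ?hterm_ge0// lee_fin ltW.
  apply/lee_addgt0Pr => e e0; rewrite add0e.
  (* Since 2s <= 1 and n > 0, (2s)^n <= 2s <= e. *)
  pose s := Num.min 2^-1 (e / 2).
  have s0 : 0 < s by rewrite lt_min invr_gt0 ltr0n divr_gt0.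
  apply: (le_trans (small s _)); rewrite -?d0// lee_fin.
  have s1 : s <= 2^-1 by rewrite ge_min lexx.
  have s2 : s <= e / 2 by rewrite ge_min lexx orbT.
  rewrite -(prednK n0) exprS; apply: (@le_trans _ _ (2 * s)); last by lra.
  by rewrite ler_piMr ?exprn_ile1//; lra.
(* With e = 2d the cube has volume (4d)^n = 8^n (d/2)^n, the source of the constant 8^n. *)
apply: (le_trans (small (2 * d) _)); first by lra.
apply: (@le_trans _ _ ((8 ^+ n / alpha R n)%:E * (alpha R n * (d / 2) ^+ n)%:E)%E).
  have aK : 8 ^+ n / alpha R n * (alpha R n * (d / 2) ^+ n) = 8 ^+ n * (d / 2) ^+ n.
    by field; rewrite gt_eqF.
  rewrite -EFinM lee_fin aK -exprMn.
  by rewrite (_ : 8 * (d / 2) = 2 * (2 * d))//; field.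
apply: lee_wpmul2l; first by rewrite lee_fin ltW.
by apply: le_hterm => //; [exact: ltW|rewrite dE].
Qed.

Lemma leb_proj_hdelta {R : realType} (n m : nat) (B : set 'rV[R]_(n + m)) : (0 < n)%N ->
  (@leb_outer R n (@projn R n m @` B) <= (8 ^+ n / alpha R n)%:E * hdelta n 1 B)%E.
Proof.
move=> n0; have K0 : 0 < 8 ^+ n / alpha R n by rewrite divr_gt0 ?exprn_gt0 ?alpha_gt0.
rewrite -lee_pdivrMl//; apply: le_mu_ext_cover => F BF.
rewrite lee_pdivrMl// -nneseriesZl; last by move=> i _; exact: hterm_ge0.
apply: (@le_trans _ _ (@leb_outer R n (\bigcup_i (@projn R n m @` F i)))).
  by apply: le_outer_measure => _ [y /BF[i _ Fi] <-]; exists i => //; exists y.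
apply: le_trans (outer_measure_sigma_subadditive _ _) _.
by apply: lee_nneseries => [i _ _|i _]; [exact: outer_measure_ge0|exact: leb_proj_le].
Qed.

Lemma leb_graph_null {R : realType} (n m : nat) (f : 'rV[R]_n -> 'rV[R]_m) A :
  (0 < n)%N -> hmeasure n (fbar f @` A) = 0%E -> @lebn R n A = 0%E.
Proof.
move=> n0 h0; apply/eqP; rewrite eq_le outer_measure_ge0 andbT.
have AE : A = @projn R n m @` (fbar f @` A).
  apply/seteqP; split => [x Ax|_ [_ [x Ax <-] <-]]; last by rewrite /projn row_mxKl.
  by exists (fbar f x); [exists x|rewrite /projn row_mxKl].
rewrite {1}AE; apply: le_trans (leb_proj_hdelta _ n0) _.
rewrite -[leRHS](mule0 (8 ^+ n / alpha R n)%:E) -h0.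
apply: lee_wpmul2l; last exact: hdelta_le_hmeasure.
by rewrite lee_fin divr_ge0 ?exprn_ge0// ltW// alpha_gt0.
Qed.

(* [lebn] unfolds to [leb_outer], which carries no canonical measure structure. *)
Section lebesgue_measure_instance.
Context {R : realType} {n : nat}.
Local Notation L := (@leb_outer R n : {outer_measure set _ -> \bar R}).

HB.instance Definition _ := isMeasure.Build _ (LebT R n) R (@lebn R n)
  (@caratheodory_measure0 R _ L) (@caratheodory_measure_ge0 R _ L)
  (@caratheodory_measure_sigma_additive R _ L).

End lebesgue_measure_instance.

(** * The measure with density the positive part of theta *)

Section positive_part_measure.
Context {R : realType} {n : nat}.
Variable theta : LebT R n -> R.
Hypothesis mtheta : measurable_fun setT theta.
Local Open Scope ereal_scope.

(* The measurability proof is an argument so that the measure structure can be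
   inferred from the term alone. *)
Definition pos_measure of measurable_fun setT theta := fun A : set (LebT R n) =>
  \int[@lebn R n]_(x in A) (Num.max (theta x) 0%R)%:E.
Local Notation nu := (pos_measure mtheta).

Lemma measurable_pos D : measurable_fun D (fun x => (Num.max (theta x) 0%R)%:E).
Proof. by apply/measurable_funTS/measurable_EFinP; exact: measurable_maxr. Qed.

Lemma pos_ge0 x : 0 <= (Num.max (theta x) 0%R)%:E.
Proof. by rewrite lee_fin le_max lexx orbT. Qed.

Let nu0 : nu set0 = 0.
Proof. by rewrite /pos_measure integral_set0. Qed.

Let nu_ge0 A : 0 <= nu A.
Proof. by apply: integral_ge0 => x _; exact: pos_ge0. Qed.

Let nu_additive : semi_sigma_additive nu.
Proof.
move=> F mF tF mUF; apply: cvg_toP.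
  apply: ereal_nondecreasing_is_cvgn => i j ij.
  by apply: lee_sum_nneg_natr => // l _ _; exact: nu_ge0.
rewrite /pos_measure ge0_integral_bigcup//; first exact: measurable_pos.
by move=> x _; exact: pos_ge0.
Qed.

HB.instance Definition _ := isMeasure.Build _ _ _ nu nu0 nu_ge0 nu_additive.

Lemma integral_le_pos D : \int[@lebn R n]_(x in D) (theta x)%:E <= nu D.
Proof.
rewrite integralE -[leRHS]adde0; apply: leeD.
  rewrite le_eqVlt; apply/orP; left; apply/eqP; apply: eq_integral => x _.
  by rewrite funeposE -EFin_max.
by rewrite leeNl oppe0; apply: integral_ge0 => x _; exact: funeneg_ge0.
Qed.

End positive_part_measure.

(** [L1loc] gives integrability on compact sets; half-open cubes inherit it from closed ones. *)
Lemma compact_cube {R : realType} (n : nat) (M : R) :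
  compact [set x : 'rV[R]_n | forall i, `[- M, M]%classic (x 0 i)].
Proof.
exact: (@rV_compact R n (fun=> `[- M, M]%classic) (fun=> segment_compact (a := - M) (b := M))).
Qed.

Lemma pos_measure_cont {R : realType} {n : nat} (theta : 'rV[R]_n -> R)
    (l1 : L1loc theta) (M e : R) : 0 < M -> 0 < e -> exists2 d : R, 0 < d &
  forall A : set (LebT R n), measurable A -> A `<=` box (const_mx (- M)) (const_mx M) ->
    (@lebn R n A <= d%:E)%E -> (pos_measure l1.1 A <= e%:E)%E.
Proof.
move=> M0 e0; set B := box _ _; have mB : measurable (B : set (LebT R n)) by exact: measurable_box.
set K := [set x : 'rV[R]_n | forall i, `[- M, M]%classic (x 0 i)].
have mK : measurable (K : set (LebT R n)).
  rewrite (_ : K = \bigcap_(i in [set: 'I_n])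
    (setT `&` ((fun x => x 0 i) : LebT R n -> R) @^-1` `[- M, M]%classic)).
    by apply: fin_bigcap_measurable => // i _; apply: measurable_coord.
  by apply/seteqP; split => x xK i; have := xK i; rewrite /= ?in_itv/=; [split|move=> /(_ I)[]].
have BK : B `<=` K.
  move=> x xB i; have := xB i; rewrite !mxE /= in_itv/= => /andP[-> /ltW].
  by [].
have intK := l1.2 _ (@compact_cube R n M).
have intB : (@lebn R n).-integrable (B : set (LebT R n)) (fun x : LebT R n => (theta x)%:E).
  exact: (integrableS mK mB BK intK).
(* Cut off outside the cube, the positive part is integrable on the whole space, where absolute
   continuity of the integral applies. *)
pose g : LebT R n -> R := (fun x => Num.max (theta x) 0) \_ (B : set (LebT R n)).
have posB : (@lebn R n).-integrable (B : set (LebT R n))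
    (fun x : LebT R n => (Num.max (theta x) 0)%:E).
  have := integrable_funepos mB intB.
  congr (integrable _ _ _); apply/funext => x.
  by rewrite funeposE -EFin_max.
have intg : (@lebn R n).-integrable setT (EFin \o g).
  have := (integrable_mkcond _ mB).1 posB.
  by rewrite -restrict_EFin.
have [d [d0 dP]] := integral_normr_continuous intg e0.
exists (d / 2) => [|A mA AB Ad]; first by rewrite divr_gt0.
have /(dP _ mA) : (@lebn R n A < d%:E)%E by rewrite (le_lt_trans Ad)// lte_fin; lra.
have nuA : pos_measure l1.1 A = (\int[@lebn R n]_(x in A) `|g x|%:E)%E.
  apply: eq_integral => x; rewrite inE => Ax; rewrite /g patchE ifT ?inE; last exact: AB.
  by rewrite ger0_norm// le_max lexx orbT.
(* [Rintegral] is the [fine] of the integral, so finiteness is needed to return to the extended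
   reals. *)
have finA : (\int[@lebn R n]_(x in A) `|g x|%:E)%E \is a fin_num.
  rewrite -nuA ge0_fin_numE ?measure_ge0//.
  apply: le_lt_trans (le_measure _ _ _ AB) _; rewrite ?inE//.
  have /integrableP[_] := posB; congr (_ < _)%E; apply: eq_integral => x _.
  by rewrite gee0_abs// pos_ge0.
rewrite nuA /Rintegral -lte_fin fineK// => /ltW.
by [].
Qed.

Theorem theorem4p4 (R : realType) (m n : nat) : (1 <= m <= n)%N ->
  exists C : R, 0 < C /\
  forall (f : 'rV[R]_n -> 'rV[R]_m) (theta : 'rV[R]_n -> R),
    W11loc f -> L1loc theta ->
    (forall (z : 'rV[R]_(n + m)) (r : R), 0 < r ->
       (hcontent (n - m) (@projn R n m @` (range (fbar f) `&` eball z r))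
        <= (r ^- m)%:E *
           \int[(@lebn R n)]_(x in @projn R n m @` (range (fbar f) `&` eball z (4 * r)))
              (theta x)%:E)%E) ->
    (forall E : set 'rV[R]_n, measurable (E : set (LebT R n)) ->
       (hmeasure n (fbar f @` E) <= C%:E * \int[(@lebn R n)]_(x in E) (theta x)%:E)%E)
    /\
    (forall E : set 'rV[R]_n, @lebn R n E = 0%E -> hmeasure n (fbar f @` E) = 0%E).
Proof.
move=> /andP[m1 mn]; have n0 : (0 < n)%N by exact: leq_trans mn.
exists (3 * @cover_const R n m); split; first by rewrite mulr_gt0// cover_const_gt0.
move=> f theta fW l1 content_theta.
have mf j : measurable_fun setT ((fun x => f x 0 j) : LebT R n -> R) := (fW j).1.1.
(* Passing to the positive part only enlarges the right-hand side of the hypothesis. *)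
pose nu := pos_measure l1.1.
have content_nu z r : 0 < r -> (hcontent (n - m) (graph_ball f z r) <=
    (r ^- m)%:E * nu (graph_ball f z (4 * r)))%E.
  move=> r0; have := content_theta z r r0; rewrite !proj_graph_ball => /le_trans; apply.
  apply: lee_wpmul2l; last exact: integral_le_pos.
  by rewrite lee_fin invr_ge0 exprn_ge0// ltW.
have main := hmeasure_graph mn n0 mf content_nu (pos_measure_cont l1).
pose P : set (LebT R n) := [set x | theta x <= 0].
have mP : measurable P.
  rewrite (_ : P = setT `&` (theta : LebT R n -> R) @^-1` `]-oo, 0]%classic).
    exact: l1.1.
  by apply/seteqP; split => x; rewrite /= in_itv/=; [|case].
have P0 : @lebn R n P = 0%E.
  apply: (leb_graph_null (f := f)) => //; apply/eqP.
  rewrite eq_le hmeasure_ge0 andbT; apply: le_trans (main _ mP) _.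
  rewrite [X in (_ * X)%E](_ : _ = 0%E) ?mule0//; apply: integral0_eq => x Px.
  by rewrite max_r.
(* Theta and its positive part can differ only on the null set [P]. *)
have nuE E : measurable (E : set (LebT R n)) ->
    (\int[@lebn R n]_(x in E) (theta x)%:E)%E = nu E.
  move=> mE; apply: ae_eq_integral => //.
  - by apply/measurable_funTS/measurable_EFinP; exact: l1.1.
  - exact: (measurable_pos l1.1).
  exists P; split => // x /= /not_implyP[_ nx]; rewrite /P/= leNgt; apply/negP => x0.
  by apply: nx; rewrite max_l// ltW.
split=> [E mE|E E0]; first by rewrite nuE//; exact: main.
(* Sets of outer measure 0 satisfy Caratheodory's criterion, so [main] covers them. *)
have mE : measurable (E : set (LebT R n)).
  apply: le_caratheodory_measurable => X.
  rewrite [A in (A + _)%E](_ : _ = 0%E); last first.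
    by apply/eqP; rewrite eq_le outer_measure_ge0 andbT -E0; exact: le_outer_measure.
  by rewrite add0e; exact: le_outer_measure.
apply/eqP; rewrite eq_le hmeasure_ge0 andbT; apply: le_trans (main _ mE) _.
rewrite [X in (_ * X)%E](_ : _ = 0%E) ?mule0//; apply: null_set_integral => //.
exact: (measurable_pos l1.1).
Qed.
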